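(* Let $v$ and $w$ be finite binary words with $\mathrm{len}(v) = \mathrm{len}(w) + 1$, and write $n = \mathrm{len}(w)$. Suppose $v$ does not contain $w$ as a (contiguous) subword. If $\mathrm{Win}\left(v,w;\tfrac{1}{2}\right) \geq \tfrac{1}{2}$, then $w \in \{1^n, 0^n\}$.
   Context: For $p\in(0,1)$, let $\mathbb{P}_p$ denote the law of an i.i.d. sequence $X_1, X_2, \ldots$ of bits with $\mathbb{P}_p(X_i = 1) = p$, $\mathbb{P}_p(X_i=0)=1-p$. For a binary word $u = u_1\cdots u_r$, let $\tau_u = \min\{t \in \mathbb{N} : X_{t-r+1}X_{t-r+2}\cdots X_t = u_1 u_2\cdots u_r\}$ be the first time $u$ appears in the sequence. Define $\mathrm{Win}(v,w;p) = \mathbb{P}_p(\tau_v < \tau_w)$. For $a\in\{0,1\}$, $a^n$ denotes the word consisting of $n$ copies of $a$. *)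

(* Defs.v *)
From mathcomp Require Export all_boot all_order all_algebra.
From mathcomp Require Export finmap.
From mathcomp Require Export all_classical all_reals all_analysis.

Set Implicit Arguments.
Unset Strict Implicit.
Unset Printing Implicit Defensive.

Import Order.TTheory GRing.Theory Num.Theory.

Local Open Scope classical_set_scope.
Local Open Scope ring_scope.

(* Binary words are terms of type seq bool, with true for the bit 1 and false
   for the bit 0.  Bit sequences are indexed from 0: the entry x i is the bit
   usually written X_(i+1). *)

(* The last size u bits among the first t bits spell u.  The condition
   size u <= t is needed because subtraction on nat is truncated. *)
Definition appears_at (u : seq bool) (x : nat -> bool) : set nat :=
  [set t | (size u <= t)%N /\
           [seq x i | i <- iota (t - size u) (size u)] = u].

(* Valued in \bar R, so that tau is +oo when u never appears; otherwise the
   infimum is a minimum, as it is taken over a set of naturals. *)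
Definition tau (R : realType) (u : seq bool) (x : nat -> bool) : \bar R :=
  ereal_inf [set (t%:R)%:E | t in appears_at u x].

Section bits.
Context {d : measure_display} {T : measurableType d} {R : realType}.
Variables (P : probability T R) (X : nat -> {RV P >-> bool}).

Definition mutually_independent : Prop :=
  forall (J : {fset nat}) (B : nat -> set bool),
    (forall i, i \in J -> measurable (B i)) ->
    P (\bigcap_(i in [set` J]) (X i @^-1` B i)) =
    (\prod_(i <- J) P (X i @^-1` B i))%E.

Definition iid_bits (p : R) : Prop :=
  [/\ forall i, P (X i @^-1` [set true]) = p%:E,
      forall i, P (X i @^-1` [set false]) = (1 - p)%:E
    & mutually_independent].

(* Depends on (P, X) only through the law of X; it is Win(v, w; p) as soon as
   iid_bits p holds. *)
Definition Win (v w : seq bool) : \bar R :=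
  P [set omega | (tau R v (X ^~ omega) < tau R w (X ^~ omega))%E].

End bits.

(* Main.v *)
Require Import Defs.
From mathcomp Require Import zify ring lra.

(** Let [N] be the first time at which [v] or [w] occurs, let [p_v] and [p_w]
    be the probabilities that the word occurring at time [N] is [v] or [w], and
    let [n] be the length of [w].  Given [N > t], the letters after time [t]
    spell [v] with probability [2^-(n+1)], so [P(N > t)] is at least
    [2^(n+1) P(N = t+n+1, v first)].  Placing [w] after time [t] instead makes
    [N = t+j] for some [1 <= j <= n], where the first [j] letters of [w] end
    the word that occurred, which bounds [P(N > t)] above.  Summing over [t], as
    in Conway's formula,
      [2^(n+1) p_v <= (w.w) p_w + (v.w) p_v],
    where [u.w] is the sum of [2^j] over the [1 <= j <= n] such that the prefix
    of length [j] of [w] is a suffix of [u].  If [w] is not constant then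
    [w.w + v.w < 2^(n+1)], so [p_v >= 1/2 >= p_w] is impossible. *)

Set Implicit Arguments.
Unset Strict Implicit.
Unset Printing Implicit Defensive.

Import Order.TTheory GRing.Theory Num.Theory.

Local Open Scope ring_scope.

(** * Overlaps of words and the bound on their weighted count *)

Lemma suffix_of_suffixes (T : eqType) (a b x : seq T) :
  suffix a x -> suffix b x -> (size a <= size b)%N -> suffix a b.
Proof.
move=> /suffixP[s ->] /suffixP[s' /eqP]; elim/last_ind: b a => [|b y IH] a.
  by rewrite leqn0 size_eq0 => _ /eqP ->.
elim/last_ind: a => [|a z _]; first by rewrite suffix0s.
rewrite !size_rcons ltnS -!rcons_cat eqseq_rcons => /andP[e /eqP ->] le_ab.
by rewrite suffix_rcons eqxx IH.
Qed.

Lemma suffix_take_nth (s t : seq bool) (j i : nat) :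
  (j <= size s)%N -> suffix (take j s) t -> (i < j)%N ->
  nth false s i = nth false t (size t - j + i).
Proof.
move=> le_js; rewrite suffixE size_takel // => /eqP e lt_ij.
by rewrite -nth_drop e nth_take.
Qed.

Lemma nth_const_nseq (s : seq bool) :
  (forall i, (i < size s)%N -> nth false s i = nth false s 0) ->
  s = nseq (size s) true \/ s = nseq (size s) false.
Proof.
move=> h; have e : s = nseq (size s) (nth false s 0).
  apply: (@eq_from_nth _ false); first by rewrite size_nseq.
  by move=> i lt_is; rewrite nth_nseq lt_is h.
by case: (nth _ _ _) e; [left | right].
Qed.

Lemma step_const (s : seq bool) (m : nat) :
  (forall i, (i.+1 < m)%N -> nth false s i = nth false s i.+1) ->
  forall i, (i < m)%N -> nth false s i = nth false s 0.
Proof.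
by move=> h; elim=> // i IH lt; rewrite -h // IH // ltnW.
Qed.

Lemma sum_pow2 (m : nat) : (\sum_(j < m) 2 ^ j.+1 = 2 ^ m.+1 - 2)%N.
Proof.
elim: m => [|m IH]; first by rewrite big_ord0.
by rewrite big_ord_recr /= IH !expnS; have := expn_gt0 2 m; lia.
Qed.

Lemma sum_pow2_le (m k : nat) (f : nat -> nat) :
  (forall j, (j < m)%N -> (f j <= k)%N) ->
  (\sum_(j < m) 2 ^ j.+1 * f j <= k * (2 ^ m.+1 - 2))%N.
Proof.
move=> h; rewrite -sum_pow2 big_distrr /=; apply: leq_sum => j _.
by rewrite mulnC leq_mul2r h ?orbT.
Qed.

(* If [v] ends with the prefix of [w] of length [size w - 1], and [w] is
   alternating or this prefix is constant, then no exponent is counted twice;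
   otherwise enough of the large exponents are missing. *)
Lemma correlation_lt (v w : seq bool) :
  ~ (w = nseq (size w) true \/ w = nseq (size w) false) -> ~~ infix w v ->
  (\sum_(j < size w) 2 ^ j.+1 *
     (suffix (take j.+1 w) w + suffix (take j.+1 w) v) < 2 ^ (size w).+1)%N.
Proof.
move=> nc niwv; set c := fun j => suffix (take j w) w.
set d := fun j => suffix (take j w) v.
have [m size_w] : exists m, size w = m.+2.
  case: w nc {niwv c d} => [|b [|b' w]]; last by exists (size w).
  - by case; left.
  - by case; case: b; [left | right].
have dn : d m.+2 = false.
  by rewrite /d -size_w take_size; apply/negP => /suffixW; apply/negP.
(* Here [n = m.+2]. If no length below [n] is counted twice, every coefficient is at most 1, since
   [d n] fails, and the powers [2, ..., 2^n] sum to [2^(n+1) - 2]. *)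
have disjoint_case : (forall j, (0 < j <= m.+1)%N -> c j -> d j -> False) ->
    (\sum_(j < size w) 2 ^ j.+1 * (c j.+1 + d j.+1) < 2 ^ (size w).+1)%N.
  move=> disj; apply: (@leq_ltn_trans (1 * (2 ^ (size w).+1 - 2))).
    apply: (sum_pow2_le (f := fun j => (c j.+1 + d j.+1)%N)) => j lt_j.
    have [jm|jm] := leqP j.+1 m.+1; first by
      have := @disj j.+1 jm; case: (c _) => //; case: (d _) => // /(_ isT isT).
    have -> : j.+1 = m.+2 by lia.
    by rewrite dn; case: (c _).
  by rewrite mul1n; have := expn_gt0 2 (size w).+1; lia.
(* A border of length [n-1] means period 1, so a constant word. *)
have c1 : c m.+1 = false.
  apply/negP => h; apply: nc; apply: nth_const_nseq; apply: step_const => i.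
  rewrite size_w !ltnS => lt_i; rewrite (suffix_take_nth _ h) ?size_w //.
  by congr nth; lia.
(* Without [d m.+1], exponent [n-1] drops out: the top term gives at most [2^n] and the lower ones,
   even counted twice, at most [2^n - 4]. *)
have [d1|d1] := boolP (d m.+1); last first.
  rewrite size_w !big_ord_recr /=.
  rewrite -/(c m.+1) -/(d m.+1) -/(c m.+2) -/(d m.+2) dn c1 (negbTE d1).
  have : (\sum_(j < m) 2 ^ j.+1 * (c j.+1 + d j.+1) <= 2 * (2 ^ m.+1 - 2))%N.
    apply: (sum_pow2_le (f := fun j => (c j.+1 + d j.+1)%N)) => j _.
    by case: (c _); case: (d _).
  by rewrite /c /d !expnS; have := expn_gt0 2 m; case: (suffix _ w) => /=; lia.
have dsub j : (j <= m.+1)%N -> d j -> suffix (take j w) (take m.+1 w).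
  move=> le_j dj; apply: (@suffix_of_suffixes _ _ _ v) => //.
  by rewrite !size_takel ?size_w //; lia.
have size_w' : size (take m.+1 w) = m.+1 by rewrite size_takel ?size_w.
have d_nth j i : (j <= m.+1)%N -> d j -> (i < j)%N ->
    nth false w i = nth false w (m.+1 - j + i).
  move=> le_j dj lt_ij; rewrite (suffix_take_nth _ (dsub _ le_j dj)) ?size_w;
    [|lia|lia].
  by rewrite size_w' nth_take //; lia.
have c_nth j i : (j <= m.+2)%N -> c j -> (i < j)%N ->
    nth false w i = nth false w (m.+2 - j + i).
  by move=> le_j cj lt_ij; rewrite (suffix_take_nth _ cj) ?size_w //; lia.
(* A border of length [n-2] means period 2, so the nonconstant [w] alternates. Then [c j] forces
   [n-j] to be even and [d j] forces [n-1-j] to be even, which is incompatible. *)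
have [c2|c2] := boolP (c m).
  have per2 i : (i < m)%N -> nth false w i = nth false w i.+2.
    by move=> lt_i; rewrite (c_nth m) //; [congr nth; lia|lia].
  have w01 : nth false w 1 = ~~ nth false w 0.
    apply/eqP; rewrite eq_sym; apply/negPn/negP => w01; apply: nc.
    have {}w01 : nth false w 0 = nth false w 1.
      by move: w01; do 2!case: (nth _ _ _).
    apply: nth_const_nseq; apply: step_const; rewrite size_w.
    elim=> // i IH lt_i.
    by rewrite -per2 ?(IH i) //; lia.
  have alt i : (i < m.+2)%N -> nth false w i = nth false w 0 (+) odd i.
    elim/ltn_ind: i => [] [|[|i]] IH lt_i; first by rewrite addbF.
      by rewrite w01 addbT.
    by rewrite -per2 ?(IH i) //= ?negbK //; lia.
  apply: disjoint_case => j /andP[j_gt0 le_j].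
  move=> /c_nth => /(_ 0 (ltac:(lia)) j_gt0) ec.
  move=> /d_nth => /(_ 0 le_j j_gt0); rewrite !addn0 in ec * => ed.
  have := alt (m.+2 - j)%N (ltac:(lia)); have := alt (m.+1 - j)%N (ltac:(lia)).
  rewrite -ec -ed; have -> : (m.+2 - j = (m.+1 - j).+1)%N by lia.
  by rewrite /=; case: (nth _ _ _); case: (odd _).
(* Now the prefix of length [n-1] has period 1, so it is constant. Any [c j] with [0 < j < n] would
   make the last letter agree with it. *)
have [d2|d2] := boolP (d m).
  have cst i : (i < m.+1)%N -> nth false w i = nth false w 0.
    apply: step_const => {}i lt_i; rewrite (d_nth m) //.
    by congr nth; lia.
  apply: disjoint_case => j /andP[j_gt0 le_j] cj _; apply: nc.
  apply: nth_const_nseq => i; rewrite size_w => lt_i.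
  have [lt|ge] := ltnP i m.+1; first exact: cst.
  have -> : i = (m.+2 - j + j.-1)%N by lia.
  by rewrite -(c_nth j) //; [apply: cst; lia|lia|lia].
(* Exponent [n-2] is now missing on both sides. The remaining terms are at most [2^n], [2^(n-1)]
   and, counted twice, [2^(n-1) - 4]. The case [m = 0] is void because the empty prefix is always a
   suffix. *)
clear dsub size_w' d_nth c_nth disjoint_case.
case: m => [|m] in size_w dn c1 d1 c2 d2 *.
  by move: c2; rewrite /c take0 suffix0s.
rewrite size_w !big_ord_recr /=.
rewrite -/(c m.+1) -/(d m.+1) -/(c m.+2) -/(d m.+2) -/(c m.+3) -/(d m.+3).
rewrite dn c1 (negbTE c2) (negbTE d2) d1.
have : (\sum_(j < m) 2 ^ j.+1 * (c j.+1 + d j.+1) <= 2 * (2 ^ m.+1 - 2))%N.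
  apply: (sum_pow2_le (f := fun j => (c j.+1 + d j.+1)%N)) => j _.
  by case: (c _); case: (d _).
by rewrite /c /d !expnS; have := expn_gt0 2 m; case: (suffix _ w) => /=; lia.
Qed.

(** * Expectations over a uniform word of length [t], built from the last letter *)

Fixpoint bit_mean (R : fieldType) (t : nat) (f : seq bool -> R) : R :=
  if t is t'.+1 then
    (bit_mean t' (fun x => f (rcons x true)) +
     bit_mean t' (fun x => f (rcons x false))) / 2
  else f [::].

Lemma bit_meanD (R : fieldType) t (f g : seq bool -> R) :
  bit_mean t (fun x => f x + g x) = bit_mean t f + bit_mean t g.
Proof. by elim: t f g => //= t IH f g; rewrite !IH; ring. Qed.

Lemma bit_meanZ (R : fieldType) t c (f : seq bool -> R) :
  bit_mean t (fun x => c * f x) = c * bit_mean t f.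
Proof. by elim: t f => //= t IH f; rewrite !IH; ring. Qed.

Lemma bit_mean_eq0 (R : fieldType) t (f : seq bool -> R) :
  (forall x, size x = t -> f x = 0) -> bit_mean t f = 0.
Proof.
elim: t f => [|t IH] f f0 /=; first exact: f0.
by rewrite !IH ?addr0 ?mul0r // => x sx; rewrite f0 // size_rcons sx.
Qed.

Lemma bit_mean_sum (R : fieldType) t m (f : 'I_m -> seq bool -> R) :
  bit_mean t (fun x => \sum_(j < m) f j x) = \sum_(j < m) bit_mean t (f j).
Proof.
elim: t f => //= t IH f; rewrite !IH -big_split /= mulr_suml.
by apply: eq_bigr.
Qed.

Lemma le_bit_mean (R : realFieldType) t (f g : seq bool -> R) :
  (forall x, f x <= g x) -> bit_mean t f <= bit_mean t g.
Proof.
elim: t f g => //= t IH f g le_fg.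
by rewrite ler_wpM2r ?invr_ge0 ?ler0n // lerD // IH.
Qed.

Lemma bit_mean_ge0 (R : realFieldType) t (f : seq bool -> R) :
  (forall x, 0 <= f x) -> 0 <= bit_mean t f.
Proof.
elim: t f => //= t IH f f_ge0.
by rewrite mulr_ge0 ?invr_ge0 ?ler0n // addr_ge0 // IH.
Qed.

(** A uniform word ends in [u] with probability [2^-(size u)], and words with another ending
    contribute nonnegatively. *)
Lemma bit_mean_cat (R : realFieldType) t (u : seq bool) (f : seq bool -> R) :
  (forall x, 0 <= f x) ->
  bit_mean t (fun x => f (x ++ u)) <= 2 ^+ size u * bit_mean (t + size u) f.
Proof.
elim/last_ind: u f => [|u b IH] f f_ge0.
  by rewrite addn0 mul1r; apply: le_bit_mean => x; rewrite cats0.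
rewrite size_rcons addnS exprSr /= mulrACA divff ?pnatr_eq0 // mulr1.
have IHb := IH (fun x => f (rcons x b)) (fun x => f_ge0 _).
apply: le_trans (_ : bit_mean t (fun x => f (rcons (x ++ u) b)) <= _).
  by apply: le_bit_mean => x; rewrite rcons_cat.
apply: le_trans IHb _; rewrite ler_wpM2l ?exprn_ge0 //.
case: b f_ge0 => f_ge0; rewrite ?lerDl ?lerDr bit_mean_ge0 //.
Qed.

(** Converse to [bit_mean_cat]: when [f] is supported on words ending in [u], the other endings
    contribute nothing and no mass is lost. *)
Lemma bit_mean_suffix (R : realFieldType) t (u : seq bool)
    (f g : seq bool -> R) :
  (forall x, ~~ suffix u x -> f x = 0) -> (forall x, f (x ++ u) <= g x) ->
  2 ^+ size u * bit_mean (t + size u) f <= bit_mean t g.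
Proof.
elim/last_ind: u f => [|u b IH] f f0 le_fg.
  rewrite addn0 mul1r; apply: le_bit_mean => x.
  by have := le_fg x; rewrite cats0.
rewrite size_rcons addnS exprSr /= mulrACA divff ?pnatr_eq0 // mulr1.
have fN : bit_mean (t + size u) (fun x => f (rcons x (~~ b))) = 0.
  apply: bit_mean_eq0 => x _; rewrite f0 // suffix_rcons.
  by case: b {IH f0 le_fg}.
have {}IH := IH (fun x => f (rcons x b)).
have -> : bit_mean (t + size u) (fun x => f (rcons x true)) +
          bit_mean (t + size u) (fun x => f (rcons x false)) =
          bit_mean (t + size u) (fun x => f (rcons x b)).
  by case: b fN {f0 le_fg IH} => /= ->; rewrite ?addr0 ?add0r.
apply: IH => x; first by move=> nx; rewrite f0 // suffix_rcons eqxx.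
by rewrite rcons_cat.
Qed.

(** * Avoidance and first occurrence in finite words *)

Definition avoids (v w x : seq bool) : bool := ~~ infix v x && ~~ infix w x.

(** The event that [N] is the length of [x] and [u] is the word occurring then. *)
Definition first_at (v w u x : seq bool) : bool :=
  suffix u x && avoids v w (take (size x).-1 x).

Lemma take_belast_rcons (x : seq bool) b :
  take (size (rcons x b)).-1 (rcons x b) = x.
Proof. by rewrite size_rcons -cats1 take_size_cat. Qed.

Lemma avoids_catl v w x y : avoids v w (x ++ y) -> avoids v w x.
Proof.
by case/andP => nv nw; apply/andP; split;
  [apply: contra nv | apply: contra nw]; apply: infix_catr.
Qed.

(* Appending [w] to a word avoiding both [v] and [w] forces a first occurrence
   of one of them after [j.+1 <= size w] more letters; the overlap is then a
   prefix of [w] that is a suffix of the word that occurred. *)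
Lemma avoids_first_occurrence v w y : ~~ infix w v -> (size w <= size v)%N ->
  avoids v w y ->
  exists2 j : 'I_(size w),
    first_at v w v (y ++ take j.+1 w) || first_at v w w (y ++ take j.+1 w) &
    (first_at v w w (y ++ take j.+1 w) -> suffix (take j.+1 w) w) /\
    (first_at v w v (y ++ take j.+1 w) -> suffix (take j.+1 w) v).
Proof.
move=> niwv le_wv av_y; pose hit j := ~~ avoids v w (y ++ take j w).
have hit_n : exists j, hit j.
  exists (size w); rewrite /hit take_size negb_and !negbK.
  by rewrite [infix w _]suffixW ?orbT // suffix_suffix.
(* The witness is the least number of letters of [w] that completes an occurrence; it is positive
   because [y] avoids both words. *)
have := ex_minnP hit_n; case=> j hit_j min_j.
have j_gt0 : (0 < j)%N.
  by case: j hit_j {min_j}; rewrite /hit ?take0 ?cats0 ?av_y.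
have le_jn : (j <= size w)%N.
  apply: min_j; rewrite /hit take_size negb_and !negbK.
  by rewrite [infix w _]suffixW ?orbT // suffix_suffix.
case: j j_gt0 le_jn hit_j min_j => // j _ lt_jn hit_j min_j.
have e_take : y ++ take j.+1 w = rcons (y ++ take j w) (nth false w j).
  by rewrite (take_nth false) // rcons_cat.
have av_j : avoids v w (y ++ take j w).
  by apply/negPn/negP => /min_j; rewrite ltnn.
exists (Ordinal lt_jn) => /=; rewrite /first_at.
  rewrite e_take take_belast_rcons av_j !andbT.
  move: hit_j av_j; rewrite /hit /avoids e_take !infix_rconsl.
  case: (infix v _) => //; case: (infix w _) => //=.
  by rewrite !orbF negb_and !negbK.
by split=> /andP[su _]; apply: suffix_of_suffixes (suffix_suffix y _) su _;
  rewrite size_takel // (leq_trans lt_jn).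
Qed.

(** This is [P(N > t)]; [first_prob] below is [P(N = t, u first)]. *)
Definition avoid_prob (R : fieldType) (v w : seq bool) (t : nat) : R :=
  bit_mean t (fun x => (avoids v w x)%:R).

Definition first_prob (R : fieldType) (v w u : seq bool) (t : nat) : R :=
  bit_mean t (fun x => (first_at v w u x)%:R).

Lemma first_prob_ge0 (R : realFieldType) v w u t : 0 <= first_prob R v w u t.
Proof. by apply: bit_mean_ge0 => x. Qed.

Lemma avoid_prob_ge0 (R : realFieldType) v w t : 0 <= avoid_prob R v w t.
Proof. by apply: bit_mean_ge0 => x. Qed.

(** If [x ++ u] is a first occurrence of [u], then [x] avoids both words: as [u] is nonempty,
    deleting the last letter leaves [x] intact. *)
Lemma first_prob_le_avoid (R : realFieldType) v w u t : u != [::] ->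
  2 ^+ size u * first_prob R v w u (t + size u) <= avoid_prob R v w t.
Proof.
case/lastP: u => // u b _; apply: bit_mean_suffix => x.
  by rewrite /first_at => /negbTE ->.
rewrite ler_nat; case: (first_at _ _ _ _) / andP => // -[_].
rewrite -rcons_cat take_belast_rcons.
by move/avoids_catl ->.
Qed.

(** Averages [avoids_first_occurrence] over words of length [t]; prescribing [j.+1] further letters
    costs a factor [2^(j+1)]. *)
Lemma avoid_prob_le_first (R : realFieldType) v w t :
  ~~ infix w v -> (size w <= size v)%N ->
  avoid_prob R v w t <= \sum_(j < size w) 2 ^+ j.+1 *
    ((suffix (take j.+1 w) w)%:R * first_prob R v w w (t + j.+1) +
     (suffix (take j.+1 w) v)%:R * first_prob R v w v (t + j.+1)).
Proof.
move=> niwv le_wv.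
pose F (j : 'I_(size w)) u x : R :=
  (suffix (take j.+1 w) u)%:R * (first_at v w u (x ++ take j.+1 w))%:R.
apply: (@le_trans _ _ (bit_mean t (fun x => \sum_j (F j w x + F j v x)))).
  apply: le_bit_mean => x; have F_ge0 j u : 0 <= F j u x by rewrite mulr_ge0.
  have [av|_] := boolP (avoids v w x); last first.
    by apply: sumr_ge0 => j _; rewrite addr_ge0.
  have [j hit [sw sv]] := avoids_first_occurrence niwv le_wv av.
  rewrite (bigD1 j) //= -[1%:R]addr0 lerD //; last first.
    by apply: sumr_ge0 => i _; rewrite addr_ge0.
  case/orP: hit => [hv|hw].
    by rewrite -[1%:R]add0r lerD // /F hv sv // mulr1.
  by rewrite -[1%:R]addr0 lerD // /F hw sw // mulr1.
rewrite bit_mean_sum; apply: ler_sum => j _.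
rewrite bit_meanD !bit_meanZ mulrDr lerD // mulrCA ler_wpM2l //.
  by have := @bit_mean_cat R t (take j.+1 w) (fun x => (first_at v w w x)%:R);
     rewrite size_takel //; apply.
by have := @bit_mean_cat R t (take j.+1 w) (fun x => (first_at v w v x)%:R);
   rewrite size_takel //; apply.
Qed.

(** The events [N > t+1] and [N = t+1] with [v] or with [w] first all lie in [N > t]. They are
    disjoint because [v] and [w] cannot end together when [w] is no subword of [v]. *)
Lemma avoid_prob_step (R : realFieldType) v w t :
  ~~ infix w v -> (size w <= size v)%N ->
  avoid_prob R v w t.+1 + (first_prob R v w v t.+1 + first_prob R v w w t.+1) <=
  avoid_prob R v w t.
Proof.
move=> niwv le_wv; rewrite /avoid_prob /first_prob.
(* Both sides become means over words of length [t+1], the right one ignoring the last letter, so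
   they can be compared pointwise. *)
have -> : bit_mean t (fun x => (avoids v w x)%:R) =
    bit_mean t.+1 (fun x => (avoids v w (take (size x).-1 x))%:R) :> R.
  have e b : bit_mean t (fun x => (avoids v w
        (take (size (rcons x b)).-1 (rcons x b)))%:R) =
      bit_mean t (fun x => (avoids v w x)%:R) :> R.
    by congr bit_mean; apply/funext => x; rewrite take_belast_rcons.
  by rewrite /= !e; field.
rewrite -!bit_meanD; apply: le_bit_mean => x; rewrite -!natrD ler_nat.
have [sv|nsv] := boolP (suffix v x); have [sw|nsw] := boolP (suffix w x).
- by case/negP: niwv; apply: suffixW; apply: suffix_of_suffixes sw sv _.
- rewrite /first_at sv (negbTE nsw) /= addn0 /avoids (suffixW sv) /=.
  by rewrite add0n; case: (_ && _).
- rewrite /first_at sw (negbTE nsv) /= add0n /avoids (suffixW sw) andbF add0n.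
  by case: (_ && _).
- rewrite /first_at (negbTE nsw) (negbTE nsv) !addn0.
  have [av|//] := boolP (avoids v w x); rewrite lt0b.
  by apply: (@avoids_catl _ _ _ (drop (size x).-1 x)); rewrite cat_take_drop.
Qed.

Lemma sum_first_prob_le1 (R : realFieldType) v w m :
  ~~ infix w v -> (size w <= size v)%N ->
  \sum_(t < m) first_prob R v w v t.+1 +
  \sum_(t < m) first_prob R v w w t.+1 <= 1.
Proof.
move=> niwv le_wv; rewrite -big_split /=.
apply: (@le_trans _ _ (avoid_prob R v w 0 - avoid_prob R v w m)).
  elim: m => [|m IH]; first by rewrite big_ord0 subrr.
  rewrite big_ord_recr /=; have := avoid_prob_step R m niwv le_wv; lra.
have := avoid_prob_ge0 R v w m; rewrite {2}/avoid_prob /=.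
by case: (avoids _ _ _) => /=; lra.
Qed.

Lemma first_prob_short (R : fieldType) v w u t : (t < size u)%N ->
  first_prob R v w u t = 0.
Proof.
move=> lt_tu; apply: bit_mean_eq0 => x sx; rewrite /first_at.
by case: (boolP (suffix u x)) => // /size_suffix; rewrite sx leqNgt lt_tu.
Qed.

Lemma sum_shift_le (R : realFieldType) (f : nat -> R) (m j : nat) :
  (forall i, 0 <= f i) -> \sum_(t < m) f (t + j)%N <= \sum_(t < m + j) f t.
Proof.
move=> f_ge0; rewrite addnC big_split_ord /=.
rewrite [X in _ <= _ + X](eq_bigr (fun t : 'I_m => f (t + j)%N)).
  by rewrite lerDr sumr_ge0.
by move=> i _; rewrite addnC.
Qed.

(** Both bounds on [P(N > t)] are summed over [t < m]. A common bound [S] for the partial sums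
    absorbs the index shifts. *)
Lemma sum_first_prob_le (R : realFieldType) v w (S : R) m :
  size v = (size w).+1 -> ~~ infix w v ->
  (forall k, \sum_(t < k) first_prob R v w v t.+1 <= S) ->
  (forall k, \sum_(t < k) first_prob R v w w t.+1 <= S) ->
  2 ^+ size v * \sum_(t < m) first_prob R v w v t.+1 <=
  (\sum_(j < size w) 2 ^ j.+1 *
     (suffix (take j.+1 w) w + suffix (take j.+1 w) v))%N%:R * S.
Proof.
move=> sv niwv le_vS le_wS.
have le_wv : (size w <= size v)%N by rewrite sv.
have shift u j : (forall k, \sum_(t < k) first_prob R v w u t.+1 <= S) ->
    \sum_(t < m) first_prob R v w u (t + j.+1) <= S.
  move=> le_uS; apply: le_trans (le_uS (m + j)%N).
  have := @sum_shift_le R (fun t => first_prob R v w u t.+1) m j.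
  under eq_bigr do rewrite -addnS; apply=> i; exact: first_prob_ge0.
apply: (@le_trans _ _ (\sum_(t < m) avoid_prob R v w t)).
  apply: (@le_trans _ _
    (2 ^+ size v * \sum_(t < m) first_prob R v w v (t + size v)%N)).
    rewrite ler_wpM2l ?exprn_ge0 //.
    apply: (@le_trans _ _ (\sum_(t < size w + m) first_prob R v w v t.+1)).
      rewrite addnC big_split_ord /= lerDl sumr_ge0 // => i _.
      exact: first_prob_ge0.
    (* The first [size w] terms vanish: [v] cannot occur before time [size w + 1]. *)
    rewrite big_split_ord /= big1 ?add0r.
      by apply: ler_sum => t _; rewrite sv addnS addnC.
    by move=> i _; rewrite first_prob_short // sv ltnS ltn_ord.
  rewrite mulr_sumr; apply: ler_sum => t _; apply: first_prob_le_avoid.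
  by rewrite -size_eq0 sv.
apply: le_trans.
  by apply: ler_sum => t _; apply: avoid_prob_le_first niwv le_wv.
rewrite exchange_big natr_sum mulr_suml; apply: ler_sum => j _ /=.
rewrite -mulr_sumr natrM natrX -mulrA ler_wpM2l ?exprn_ge0 //.
rewrite big_split /= -!mulr_sumr natrD mulrDl.
by rewrite lerD // ler_wpM2l // shift.
Qed.

Local Open Scope classical_set_scope.

(** * Occurrence times in an infinite bit sequence *)

Lemma appears_atP (u : seq bool) (x : nat -> bool) (t : nat) :
  appears_at u x t <-> suffix u (mkseq x t).
Proof.
rewrite /appears_at /= suffixE size_mkseq /mkseq -map_drop drop_iota.
split=> [[le_ut e]|/eqP e]; first by rewrite add0n subKn // e.
have le_ut : (size u <= t)%N.
  by rewrite -e size_map size_iota leq_subr.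
by split=> //; move: e; rewrite add0n subKn.
Qed.

Lemma infix_mkseq (u : seq bool) (x : nat -> bool) (t : nat) :
  reflect (exists2 s, (s <= t)%N & suffix u (mkseq x s))
          (infix u (mkseq x t)).
Proof.
apply: (iffP idP) => [|[s le_st su]]; last first.
  rewrite -(subnKC le_st) /mkseq iotaD map_cat.
  by apply: infix_catr; apply: suffixW.
elim: t => [|t IH].
  by rewrite infixs0 => /eqP ->; exists 0%N => //; rewrite suffix0s.
rewrite mkseqS infix_rconsl -mkseqS => /orP[su|/IH[s le_st su]].
  by exists t.+1.
by exists s => //; apply: leqW.
Qed.

Lemma tau_ltP (R : realType) (v w : seq bool) (x : nat -> bool) :
  v != [::] -> (size w <= size v)%N -> ~~ infix w v ->
  (tau R v x < tau R w x)%E <->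
  exists t, first_at v w v (mkseq x t.+1).
Proof.
move=> v0 le_wv niwv; have take_mkseq t : take t (mkseq x t.+1) = mkseq x t.
  by rewrite mkseqS -cats1 take_size_cat ?size_mkseq.
split=> [/ereal_inf_lt[_ [t0 /appears_atP at0 <-] lt_t0w]|[t]].
  have := ex_minnP (ex_intro (fun t => suffix v (mkseq x t)) t0 at0).
  case=> -[|t] at_t min_t.
    by move: at_t; rewrite suffixs0 (negbTE v0).
  exists t; rewrite /first_at at_t size_mkseq /= take_mkseq /avoids.
  apply/andP; split; apply/negP => /infix_mkseq[s le_st su].
    by have := min_t _ su; rewrite ltnNge le_st.
  have : (tau R w x <= s%:R%:E)%E.
    by apply: ereal_inf_lbound; exists s => //; apply/appears_atP.
  move=> /(lt_le_trans lt_t0w); rewrite lte_fin ltr_nat ltnNge.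
  by rewrite (leq_trans le_st) // ltnW // min_t.
rewrite /first_at size_mkseq /= take_mkseq => /andP[sv /andP[_ nw]].
apply: (@le_lt_trans _ _ (t.+1)%:R%:E).
  by apply: ereal_inf_lbound; exists t.+1 => //; apply/appears_atP.
(* With [v] first at time [t+1], [w] has not occurred by time [t], and at [t+1] it would be a suffix
   of [v]; so it occurs no earlier than [t+2]. *)
apply: (@lt_le_trans _ _ (t.+2)%:R%:E); first by rewrite lte_fin ltr_nat.
apply: le_ereal_inf_tmp => _ [s /appears_atP sw <-]; rewrite lee_fin ler_nat.
rewrite ltnNge leq_eqVlt ltnS negb_or; apply/andP; split.
  apply: contra niwv => /eqP es; rewrite es in sw.
  exact/suffixW/(suffix_of_suffixes sw sv).
by apply: contra nw => le_st; apply/infix_mkseq; exists s.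
Qed.

Lemma first_at_inj (v w : seq bool) (x : nat -> bool) (s t : nat) :
  first_at v w v (mkseq x s.+1) -> first_at v w v (mkseq x t.+1) -> s = t.
Proof.
wlog lt_st : s t / (s < t)%N => [th|] hs ht.
  by case: (ltngtP s t) => // lt; [apply: th | apply/esym/th].
move: ht; rewrite /first_at size_mkseq mkseqS /=.
rewrite -cats1 take_size_cat ?size_mkseq // => /andP[_ /andP[/negP[]]].
by apply/infix_mkseq; exists s.+1 => //; case/andP: hs.
Qed.

(** * The law of the first bits, and [Win] as a series *)

Lemma measurable_bits {R : realType} {d : measure_display}
    {T : measurableType d} (P : probability T R) (X : nat -> {RV P >-> bool})
    (M : nat) (f : pred (seq bool)) :
  measurable [set omega | f (mkseq (X ^~ omega) M)].
Proof.
elim: M f => [|M IH] f.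
  have [f0|nf0] := boolP (f [::]).
    by rewrite (_ : [set _ | _] = setT) //; apply/seteqP; split.
  rewrite (_ : [set _ | _] = set0) //.
  by apply/seteqP; split => //= o /(negP nf0).
rewrite (_ : [set _ | _] =
    ([set omega | f (rcons (mkseq (X ^~ omega) M) true)]
         `&` X M @^-1` [set true])
    `|` ([set omega | f (rcons (mkseq (X ^~ omega) M) false)]
         `&` X M @^-1` [set false])).
  apply: measurableU; (apply: measurableI;
    [exact: (IH (fun x => f (rcons x _))) | exact: measurable_funPTI]).
apply/seteqP; split => o /=; rewrite mkseqS.
  by case: (X M o) => fo; [left | right].
by case=> -[fo ->].
Qed.

(* The condition on the bits after [M] makes the induction on [M] go through. *)
Lemma prob_bits_tail {R : realType} {d : measure_display}
    {T : measurableType d} (P : probability T R) (X : nat -> {RV P >-> bool})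
    (M : nat) (f : pred (seq bool)) (s : seq bool) :
  iid_bits X (1 / 2) ->
  P [set omega | f (mkseq (X ^~ omega) M) /\
       forall i, (i < size s)%N -> X (M + i)%N omega = nth false s i] =
  (bit_mean M (fun x => (f x)%:R) / 2 ^+ size s)%:E.
Proof.
case=> X1 X0 indep.
have meas M' (g : pred (seq bool)) u :
  measurable [set o | g (mkseq (X ^~ o) M') /\
    forall i, (i < size u)%N -> X (M' + i)%N o = nth false u i].
  pose h x := g (take M' x) && (drop M' x == u).
  rewrite (_ : [set _ | _] = [set o | h (mkseq (X ^~ o) (M' + size u))]).
    exact: (measurable_bits X (M' + size u) h).
  apply/seteqP; split => o; rewrite /h /= /mkseq -map_take -map_drop;
    rewrite take_iota drop_iota (minn_idPl (leq_addr _ _)) addKn add0n.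
    case=> -> eX; apply/eqP; apply: (@eq_from_nth _ false).
      by rewrite size_map size_iota.
    move=> i; rewrite size_map size_iota => lt_i.
    by rewrite (nth_map 0) ?size_iota // nth_iota // eX.
  case/andP=> -> /eqP e; split=> // i lt_i.
  by rewrite -e (nth_map 0) ?size_iota // nth_iota.
elim: M f s => [|M IH] f s.
  have [f0|nf0] := boolP (f [::]); last first.
    rewrite (_ : [set _ | _] = set0) /= ?(negbTE nf0) ?mul0r ?measure0 //.
    by apply/seteqP; split => o /= [].
  have Xb i b : P (X i @^-1` [set b]) = (2^-1)%:E.
    by case: b; rewrite ?X1 ?X0; congr (_%:E); field.
  (* With no bits left in the word, the event is a cylinder on the first [size s] bits, and
     independence gives its probability. *)
  pose J := seq_fset tt (iota 0 (size s)).
  have memJ i : (i \in J) = (i < size s)%N by rewrite seq_fsetE mem_iota.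
  have := indep J (fun i => [set nth false s i]) (fun _ _ => I).
  rewrite (eq_bigr (fun=> (2^-1)%:E)) => [|i _]; last exact: Xb.
  rewrite prodEFin big_const_seq count_predT iter_mulr_1.
  have -> : size J = size s.
    by rewrite size_seq_fset undup_id ?iota_uniq ?size_iota.
  rewrite /= f0 mul1r -exprVn => <-; congr (P _).
  apply/seteqP; split => o /=.
    by case=> _ h i /=; rewrite memJ => /h.
  by move=> h; split=> // i lt_i; apply: h; rewrite /= memJ.
(* Splitting on the value of bit [M] moves it from the end of the word to the head of the prescribed
   tail. *)
rewrite (_ : [set _ | _] =
    [set o | f (rcons (mkseq (X ^~ o) M) true) /\ forall i,
        (i < size (true :: s))%N -> X (M + i)%N o = nth false (true :: s) i] `|`
    [set o | f (rcons (mkseq (X ^~ o) M) false) /\ forall i,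
        (i < size (false :: s))%N -> X (M + i)%N o = nth false (false :: s) i]).
  rewrite measureU.
  - pose mu b : R := bit_mean M (fun x => (f (rcons x b))%:R).
    transitivity ((mu true / 2 ^+ (size s).+1)%:E +
                  (mu false / 2 ^+ (size s).+1)%:E)%E.
      by congr (_ + _)%E; [exact: (IH (fun x => f (rcons x true)) (true :: s))
                        |exact: (IH (fun x => f (rcons x false)) (false :: s))].
    rewrite -EFinD /= exprS; congr (_%:E); rewrite /mu; field.
    by rewrite expf_neq0 ?pnatr_eq0.
  - exact: meas (fun x => f (rcons x true)) (true :: s).
  - exact: meas (fun x => f (rcons x false)) (false :: s).
  - apply/seteqP; split => //= o [[_ h1] [_ h2]].
    by have := h1 0 isT; rewrite (h2 0 isT).
apply/seteqP; split => o /=; rewrite mkseqS.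
  case=> fo h; case eX: (X M o) fo => fo; [left | right].
    by split=> // -[|i] lt_i; rewrite ?addn0 // -addSnnS; apply: h.
  by split=> // -[|i] lt_i; rewrite ?addn0 // -addSnnS; apply: h.
case=> -[fo h].
  have := h 0 isT; rewrite addn0 /= => ->; split=> // i lt_i.
  by rewrite addSnnS; apply: (h i.+1).
have := h 0 isT; rewrite addn0 /= => ->; split=> // i lt_i.
by rewrite addSnnS; apply: (h i.+1).
Qed.

Lemma prob_bits {R : realType} {d : measure_display} {T : measurableType d}
    (P : probability T R) (X : nat -> {RV P >-> bool}) (M : nat)
    (f : pred (seq bool)) :
  iid_bits X (1 / 2) ->
  P [set omega | f (mkseq (X ^~ omega) M)] =
  (bit_mean M (fun x => (f x)%:R))%:E.
Proof.
move=> iidX; have := prob_bits_tail M f [::] iidX; rewrite /= divr1 => <-.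
by congr (P _); apply/seteqP; split => o //= -[].
Qed.

(** The event that [v] wins is the disjoint union, over [t], of the events that [v] occurs first at
    time [t+1]. *)
Lemma Win_series {R : realType} {d : measure_display} {T : measurableType d}
    (P : probability T R) (X : nat -> {RV P >-> bool}) (v w : seq bool) :
  iid_bits X (1 / 2) -> v != [::] -> (size w <= size v)%N -> ~~ infix w v ->
  Win X v w = (\sum_(0 <= t <oo) (first_prob R v w v t.+1)%:E)%E.
Proof.
move=> iidX v0 le_wv niwv.
pose F t := [set omega | first_at v w v (mkseq (X ^~ omega) t.+1)].
transitivity (P (\bigcup_t F t)).
  congr (P _); apply/seteqP; split => o /=.
    by move=> /(tau_ltP R (X ^~ o) v0 le_wv niwv)[t ?]; exists t.
  by case=> t _ ?; apply/(tau_ltP R (X ^~ o) v0 le_wv niwv); exists t.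
have mF t : measurable (F t).
  exact: (measurable_bits X t.+1 (first_at v w v)).
rewrite measure_semi_bigcup //.
- by apply: eq_eseriesr => t _; apply: prob_bits.
- apply/trivIsetP => s t _ _ /eqP st.
  by apply/seteqP; split => o //= -[/first_at_inj h /h].
- exact: bigcup_measurable.
Qed.

Theorem theorem3p1 (R : realType) (d : measure_display) (T : measurableType d)
    (P : probability T R) (X : nat -> {RV P >-> bool})
    (v w : seq bool) (n : nat) :
  iid_bits X (1 / 2) ->
  n = size w ->
  size v = (size w).+1 ->
  ~~ infix w v ->
  ((1 / 2)%:E <= Win X v w)%E ->
  w = nseq n true \/ w = nseq n false.
Proof.
move=> iidX -> sv niwv win; apply: contrapT => nc.
have le_wv : (size w <= size v)%N by rewrite sv.
rewrite (Win_series iidX _ le_wv niwv) in win; last by rewrite -size_eq0 sv.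
set p := fun t => first_prob R v w v t.+1.
set q := fun t => first_prob R v w w t.+1.
(* Independent cutoffs [k] and [m] allow the limit in [k] while [m] stays fixed. *)
have sums_le k m : \sum_(t < k) p t + \sum_(t < m) q t <= 1.
  apply: le_trans (sum_first_prob_le1 R (k + m) niwv le_wv); apply: lerD.
    by rewrite big_split_ord /= lerDl sumr_ge0 // => i _; apply: first_prob_ge0.
  rewrite addnC big_split_ord /= lerDl sumr_ge0 // => i _.
  exact: first_prob_ge0.
have p_ge0 t : (0%:E <= (p t)%:E)%E by rewrite lee_fin first_prob_ge0.
have series_le c : (forall k, \sum_(t < k) p t <= c) ->
    (\sum_(0 <= t <oo) (p t)%:E <= c%:E)%E.
  move=> le_c; apply: lime_le; first by apply: is_cvg_nneseries.
  by apply: nearW => k; rewrite big_mkord sumEFin lee_fin.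
have series_ge k : ((\sum_(t < k) p t)%:E <= \sum_(0 <= t <oo) (p t)%:E)%E.
  have := nneseries_lim_ge k (fun t _ _ => p_ge0 t) (m := 0) (P := xpredT).
  by rewrite big_mkord sumEFin.
have p_le1 k : \sum_(t < k) p t <= 1.
  by have := sums_le k 0; rewrite big_ord0 addr0.
have [S eS] : exists S, (\sum_(0 <= t <oo) (p t)%:E)%E = S%:E.
  have := series_le _ p_le1; have := series_ge 0%N; rewrite big_ord0.
  by case: (limn _) => // S _ _; exists S.
rewrite -/p eS in win; rewrite eS in series_le series_ge.
rewrite lee_fin in win.
have p_leS k : \sum_(t < k) p t <= S by rewrite -lee_fin.
(* Letting [k] grow gives [S + \sum q <= 1], and [S >= 1/2], so the partial sums for [w] are at most
   [1/2 <= S]. *)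
have q_leS m : \sum_(t < m) q t <= S.
  have : S <= 1 - \sum_(t < m) q t.
    by rewrite -lee_fin; apply: series_le => k; have := sums_le k m; lra.
  by move: win; lra.
have := correlation_lt nc niwv; set c := (\sum_(j < _) _)%N => lt_c.
have {}lt_c : c%:R < 2 ^+ size v :> R by rewrite -natrX ltr_nat sv.
have pow_gt0 : 0 < 2 ^+ size v :> R by rewrite exprn_gt0.
have S_gt0 : 0 < S by move: win; lra.
(* Passing to the limit yields [2^(n+1) S <= c S], which contradicts [c < 2^(n+1)] since [S > 0]. *)
have : S <= c%:R * S / 2 ^+ size v.
  rewrite -lee_fin; apply: series_le => k; rewrite ler_pdivlMr // mulrC.
  exact: sum_first_prob_le sv niwv p_leS q_leS.
by rewrite ler_pdivlMr // mulrC ler_pM2r // leNgt lt_c.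
Qed.
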